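(* The class of layered permutations, i.e. the permutation class $\mathrm{Av}(\{231,312\})$, is unsplittable.
   Context: A permutation of order $n\ge 1$ is a sequence of the $n$ distinct numbers of $[n]=\{1,\dots,n\}$ (permutations are nonempty). A permutation $\pi$ contains a permutation $\sigma$ if $\pi$ has a subsequence order-isomorphic to $\sigma$; otherwise $\pi$ avoids $\sigma$. $\mathrm{Av}(F)$ is the set of all permutations avoiding every element of $F$. Layered permutations are the elements of $\mathrm{Av}(\{231,312\})$; equivalently, they are the direct sums of decreasing permutations. A permutation class is a set of permutations closed under taking contained permutations. For permutation classes $P_1,\dots,P_m$, let $P_1\odot\dots\odot P_m$ be the set of all permutations whose entries can be colored by $m$ colors so that for each $i$ the subsequence of color $i$ is either empty or order-isomorphic to an element of $P_i$. A multiset $\{P_1,\dots,P_m\}$ of permutation classes is a splitting of a class $C$ if $C\subseteq P_1\odot\dots\odot P_m$; the $P_i$ are its parts. The splitting is nontrivial if no part is a superset of $C$. A class is splittable if it has a nontrivial splitting, and unsplittable otherwise. *)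

(* Defs.v *)
From HB Require Import structures.
From mathcomp Require Import all_boot.

Set Implicit Arguments.
Unset Strict Implicit.
Unset Printing Implicit Defensive.

Definition is_permutation (s : seq nat) : bool :=
  (0 < size s) && perm_eq s (iota 1 (size s)).

(* One-line notation; the order is the size of the sequence and is positive. *)
Record permutation : Type := Permutation {
  perm_seq :> seq nat;
  perm_seqP : is_permutation perm_seq
}.

HB.instance Definition _ := [isSub for perm_seq].
HB.instance Definition _ := [Equality of permutation by <:].

(* Meant for sequences without repetition, where comparing [<] at all pairs of
   positions determines the relative order. *)
Definition order_isomorphic (s t : seq nat) : Prop :=
  size s = size t /\
  forall i j, i < size s -> j < size s ->
    (nth 0 s i < nth 0 s j) = (nth 0 t i < nth 0 t j).

(* [subseq] is the not necessarily contiguous subsequence relation. *)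
Definition contains (p s : permutation) : Prop :=
  exists2 t : seq nat, subseq t p & order_isomorphic t s.

Definition avoids (p s : permutation) : Prop := ~ contains p s.

Record permClass : Type := PermClass {
  in_class :> permutation -> Prop;
  in_classP : forall p s, in_class p -> contains p s -> in_class s
}.

Definition subclass (C D : permutation -> Prop) : Prop :=
  forall p, C p -> D p.

Lemma order_isomorphic_mask (m : bitseq) (s t : seq nat) :
  order_isomorphic s t -> order_isomorphic (mask m s) (mask m t).
Proof.
move=> [eq_sz iso_st].
have maskE (r : seq nat) :
    mask m r = map (nth 0 r) (mask m (iota 0 (size r))).
  by rewrite -[LHS](congr1 (mask m) (mkseq_nth 0 r)) /mkseq map_mask.
rewrite (maskE s) (maskE t) -eq_sz; set k := mask m _.
have k_lt i : i < size k -> nth 0 k i < size s.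
  by move=> /(mem_nth 0) /mem_mask; rewrite mem_iota.
split=> [|i j]; first by rewrite !size_map.
rewrite size_map => lt_i lt_j.
by rewrite !(nth_map 0) //; apply: iso_st; apply: k_lt.
Qed.

Lemma contains_trans (p q s : permutation) :
  contains p q -> contains q s -> contains p s.
Proof.
move=> [t sub_tp iso_tq] [_ /subseqP[m _ ->] [sz_ms iso_ms]].
have [sz_m iso_m] := order_isomorphic_mask m iso_tq.
exists (mask m t); first exact: subseq_trans (mask_subseq m t) sub_tp.
split=> [|i j lt_i lt_j]; first by rewrite sz_m.
by rewrite iso_m // iso_ms // -sz_m.
Qed.

Lemma avoiders_closed (F : permutation -> Prop) (p s : permutation) :
  (forall f, F f -> avoids p f) -> contains p s ->
  forall f, F f -> avoids s f.
Proof. by move=> avF ps f Ff sf; apply: (avF f Ff (contains_trans ps sf)). Qed.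

Definition Av (F : permutation -> Prop) : permClass :=
  PermClass (@avoiders_closed F).

(* The entries of a permutation are distinct, so a coloring of the entries is
   given on their values; colors assigned to other numbers are irrelevant.
   For [m = 0] there is no coloring, in agreement with permutations being
   nonempty. *)
Definition odot (m : nat) (P : 'I_m -> permClass) (p : permutation) : Prop :=
  exists c : nat -> 'I_m, forall i : 'I_m,
    let q := [seq x <- p | c x == i] in
    q = [::] \/ exists2 s : permutation, P i s & order_isomorphic q s.

(* The multiset of parts is presented as an indexed family. *)
Definition splitting (C : permClass) (m : nat) (P : 'I_m -> permClass) : Prop :=
  subclass C (odot P).

Definition nontrivial_splitting
    (C : permClass) (m : nat) (P : 'I_m -> permClass) : Prop :=
  splitting C P /\ forall i : 'I_m, ~ subclass C (P i).

Definition splittable (C : permClass) : Prop :=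
  exists (m : nat) (P : 'I_m -> permClass), nontrivial_splitting C P.

Definition unsplittable (C : permClass) : Prop := ~ splittable C.

Definition perm231 : permutation := @Permutation [:: 2; 3; 1] isT.
Definition perm312 : permutation := @Permutation [:: 3; 1; 2] isT.

Definition layered : permClass :=
  Av (fun s => s = perm231 \/ s = perm312).

(* Main.v *)
(** If a splitting were nontrivial, every part would miss some layered
permutation; let [n] bound the orders of those.  Color a direct sum of
[m * n + 1] decreasing permutations of order [m * n + 1] by [m] colors.  Every
layer has a majority color used more than [n] times in it, and more than [n]
layers share the same majority color; that color class contains all layered
permutations of order at most [n], including the one its part misses. *)
From Stdlib Require Import Classical.
From mathcomp Require Import all_boot zify.
Require Import Defs.

Set Implicit Arguments.
Unset Strict Implicit.
Unset Printing Implicit Defensive.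

(** * Subsequences and small patterns *)

(** A repetition-free list has only one sorted arrangement under an antisymmetric transitive
    relation, so filtering [t] by membership in [s] returns [s] itself. *)
Lemma sorted_subset_subseq (T : eqType) (r : rel T) (s t : seq T) :
  transitive r -> antisymmetric r -> sorted r s -> sorted r t ->
  uniq s -> uniq t -> {subset s <= t} -> subseq s t.
Proof.
move=> r_tr r_anti s_sorted t_sorted s_uniq t_uniq sub_st.
suff -> : s = [seq x <- t | x \in s] by apply: filter_subseq.
apply: (sorted_eq r_tr r_anti) => //; first exact: sorted_filter.
apply: uniq_perm => //; first exact: filter_uniq.
by move=> x; rewrite mem_filter; case: (boolP (x \in s)) => // /sub_st ->.
Qed.

Lemma subseq_nth3 (s : seq nat) i j k :
  i < j -> j < k -> k < size s ->
  subseq [:: nth 0 s i; nth 0 s j; nth 0 s k] s.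
Proof.
move=> lt_ij lt_jk lt_k.
rewrite -[X in subseq _ X](mkseq_nth 0) /mkseq.
apply: (map_subseq (nth 0 s) (s1 := [:: i; j; k])).
apply: (sorted_subset_subseq leq_trans anti_leq) => /=.
- by rewrite (ltnW lt_ij) (ltnW lt_jk).
- exact: iota_sorted.
- by rewrite !inE; lia.
- exact: iota_uniq.
by move=> x; rewrite !inE mem_iota; lia.
Qed.

Lemma order_isomorphic_map (f : nat -> nat) (s : seq nat) :
  {in s &, {mono f : x y / x < y}} -> order_isomorphic (map f s) s.
Proof.
move=> f_mono; split=> [|i j]; rewrite size_map // => lt_i lt_j.
by rewrite !(nth_map 0) // f_mono ?mem_nth.
Qed.

Lemma layered_no231 (s : permutation) i j k :
  layered s -> i < j -> j < k -> k < size s ->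
  nth 0 s k < nth 0 s i -> nth 0 s i < nth 0 s j -> False.
Proof.
move=> s_lay lt_ij lt_jk lt_k lt_ki lt_ij'.
apply: (s_lay perm231 (or_introl erefl)).
exists [:: nth 0 s i; nth 0 s j; nth 0 s k]; first exact: subseq_nth3.
by split=> // [] [|[|[|?]]] [|[|[|?]]] //= _ _; lia.
Qed.

Lemma layered_no312 (s : permutation) i j k :
  layered s -> i < j -> j < k -> k < size s ->
  nth 0 s j < nth 0 s k -> nth 0 s k < nth 0 s i -> False.
Proof.
move=> s_lay lt_ij lt_jk lt_k lt_jk' lt_ki.
apply: (s_lay perm312 (or_intror erefl)).
exists [:: nth 0 s i; nth 0 s j; nth 0 s k]; first exact: subseq_nth3.
by split=> // [] [|[|[|?]]] [|[|[|?]]] //= _ _; lia.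
Qed.

Lemma permutation_uniq (s : permutation) : uniq s.
Proof. by case/andP: (perm_seqP s) => _ /perm_uniq->; apply: iota_uniq. Qed.

Lemma mem_permutation (s : permutation) v : (v \in (s : seq nat)) = (0 < v <= size s).
Proof. by case/andP: (perm_seqP s) => _ /perm_mem->; rewrite mem_iota. Qed.

(** * Layers read off from positions *)

(* In a layered permutation, the first entry that is at least [v] is the first
   entry of the layer of [v], so its position identifies the layer. *)
Definition layer_start (s : seq nat) (v : nat) : nat := find (leq v) s.

Lemma layer_start_mono (s : seq nat) v w :
  v <= w -> layer_start s v <= layer_start s w.
Proof. by move=> le_vw; apply: sub_find => x /=; apply: leq_trans. Qed.

Lemma layer_start_le (s : seq nat) i :
  i < size s -> layer_start s (nth 0 s i) <= i.
Proof.
move=> lt_i; rewrite leqNgt; apply/negP => /(before_find 0).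
by rewrite leqnn.
Qed.

Lemma le_nth_layer_start (s : seq nat) v :
  v \in s -> v <= nth 0 s (layer_start s v).
Proof. by move=> v_s; apply: (nth_find 0); apply/hasP; exists v => /=. Qed.

(** With a common start [l], the entries at [l], [i], [j] would form 312: the one at [l] is at least
    the larger value, and [l] can be neither [i] nor [j]. *)
Lemma layer_start_ascent (s : permutation) i j :
  layered s -> i < j -> j < size s -> nth 0 s i < nth 0 s j ->
  layer_start s (nth 0 s i) < layer_start s (nth 0 s j).
Proof.
move=> s_lay lt_ij lt_j lt_v; have lt_i := ltn_trans lt_ij lt_j.
rewrite ltn_neqAle layer_start_mono ?(ltnW lt_v) // andbT.
apply/eqP => eq_l; set l := layer_start s (nth 0 s j) in eq_l.
have le_li : l <= i by rewrite -eq_l layer_start_le.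
have lt_lj : l < j := leq_ltn_trans le_li lt_ij.
have le_jl : nth 0 s j <= nth 0 s l by apply/le_nth_layer_start/mem_nth.
have ne_li : l != i by apply/eqP => l_i; move: le_jl; rewrite l_i; lia.
have ne_jl : nth 0 s j != nth 0 s l.
  by rewrite nth_uniq ?permutation_uniq ?gtn_eqF // (ltn_trans lt_lj).
by apply: (layered_no312 (i := l) s_lay _ lt_ij lt_j lt_v); lia.
Qed.

(** If the larger value started later, the entry at the start [l] of the smaller one would lie
    strictly between the two values, and [l], [i], [j] would form 231. *)
Lemma layer_start_descent (s : permutation) i j :
  layered s -> i < j -> j < size s -> nth 0 s j < nth 0 s i ->
  layer_start s (nth 0 s i) = layer_start s (nth 0 s j).
Proof.
move=> s_lay lt_ij lt_j lt_v; have lt_i := ltn_trans lt_ij lt_j.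
apply/eqP; rewrite eqn_leq [X in _ && X]layer_start_mono ?(ltnW lt_v) // andbT.
rewrite leqNgt; apply/negP => lt_l; set l := layer_start s (nth 0 s j) in lt_l.
have lt_li : l < i := leq_trans lt_l (layer_start_le lt_i).
have lt_lj : l < j := ltn_trans lt_li lt_ij.
have le_jl : nth 0 s j <= nth 0 s l by apply/le_nth_layer_start/mem_nth.
have ne_jl : nth 0 s j != nth 0 s l.
  by rewrite nth_uniq ?permutation_uniq ?gtn_eqF // (ltn_trans lt_lj).
have lt_vl : nth 0 s l < nth 0 s i by rewrite ltnNge (before_find 0 lt_l).
by apply: (layered_no231 s_lay lt_li lt_ij lt_j _ lt_vl); lia.
Qed.

(** * Direct sums of decreasing blocks *)

Definition block (N x : nat) : nat := x.-1 %/ N.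

(** The order of appearance in a direct sum of decreasing permutations of order [N]. With it, being
    a subsequence reduces, for repetition-free lists, to sortedness and inclusion. *)
Definition block_le (N : nat) : rel nat :=
  fun x y => (block N x < block N y) || (block N x == block N y) && (y <= x).

Lemma block_mono N x y : x <= y -> block N x <= block N y.
Proof. by move=> le_xy; apply: leq_div2r; lia. Qed.

Lemma block_le_trans N : transitive (block_le N).
Proof. by move=> y x z; rewrite /block_le; lia. Qed.

Lemma block_le_anti N : antisymmetric (block_le N).
Proof. by move=> x y; rewrite /block_le; lia. Qed.

Lemma block_le_total N : total (block_le N).
Proof. by move=> x y; rewrite /block_le; lia. Qed.

Lemma grid_is_permutation k :
  is_permutation (sort (block_le k.+1) (iota 1 (k.+1 * k.+1))).
Proof. by rewrite /is_permutation size_sort size_iota perm_sort perm_refl. Qed.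

(* The direct sum of [k.+1] decreasing permutations of order [k.+1]. *)
Definition grid k : permutation := Permutation (grid_is_permutation k).

Lemma grid_sorted k : sorted (block_le k.+1) (grid k).
Proof. exact: sort_sorted (@block_le_total _) _. Qed.

Lemma mem_grid k x : (x \in (grid k : seq nat)) = (0 < x <= k.+1 * k.+1).
Proof. by rewrite mem_sort mem_iota. Qed.

(** Along the grid block numbers never drop, and they grow at each ascent. Both patterns contain an
    ascent, so their last entry would lie in a later block than the first, although it is
    smaller. *)
Lemma grid_layered k : layered (grid k).
Proof.
have sub3 t : subseq t (grid k) -> sorted (block_le k.+1) t.
  by move=> /subseq_sorted; apply; [apply: block_le_trans | apply: grid_sorted].
move=> f [] -> [[|a [|b [|c [|? ?]]]] /sub3 + [//= _ iso]] => /and3P[Rab Rbc _].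
- have := iso 0 1 isT isT; have := iso 2 0 isT isT => /= ca ab.
  have := @block_mono k.+1 c a; have := @block_mono k.+1 a b.
  by move: Rab Rbc; rewrite /block_le; lia.
- have := iso 1 2 isT isT; have := iso 2 0 isT isT => /= ca bc.
  have := @block_mono k.+1 c a; have := @block_mono k.+1 b c.
  by move: Rab Rbc; rewrite /block_le; lia.
Qed.

(** * Majority colors and embedding *)

Lemma pigeonhole (T : Type) (m n : nat) (c : T -> 'I_m) (s : seq T) :
  m * n < size s -> exists i : 'I_m, n < size [seq x <- s | c x == i].
Proof.
move=> lt_s; apply/existsP; apply: contraLR lt_s => /existsPn small.
rewrite -leqNgt -sum1_size (partition_big c xpredT) //=.
rewrite -[m in m * n]card_ord -sum_nat_const; apply: leq_sum => i _.
by rewrite sum1_count -size_filter leqNgt.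
Qed.

(* [g a v] is a point of the [a]-th of [n] chosen blocks, increasing in [v]. *)
Lemma subseq_of_layered (N n : nat) (q : seq nat) (g : nat -> nat -> nat)
    (s : permutation) :
  layered s -> size s <= n -> uniq q -> sorted (block_le N) q ->
  (forall a v, a < n -> v <= n -> g a v \in q) ->
  (forall a v w, a < n -> v <= n -> w <= n ->
    block N (g a v) = block N (g a w)) ->
  (forall a v w, a < n -> v < w -> w <= n -> g a v < g a w) ->
  (forall a b v w, a < b -> b < n -> v <= n -> w <= n ->
    block N (g a v) < block N (g b w)) ->
  exists2 t, subseq t q & order_isomorphic t s.
Proof.
move=> s_lay le_n q_uniq q_sorted g_in g_block g_lt g_blt.
pose f v := g (layer_start s v) v.
have s_le v : v \in (s : seq nat) -> v <= n.
  by rewrite mem_permutation => /andP[_] /leq_trans; apply.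
have l_lt v : v \in (s : seq nat) -> layer_start s v < n.
  move=> v_s; apply: leq_trans le_n.
  by rewrite -has_find; apply/hasP; exists v => /=.
have f_lt : {in (s : seq nat) &, {homo f : v w / v < w}}.
  move=> v w v_s w_s lt_vw; rewrite /f.
  have := layer_start_mono s (ltnW lt_vw); rewrite leq_eqVlt.
  case/orP=> [/eqP -> | lt_l]; first by apply: g_lt; auto.
  have := g_blt _ _ v w lt_l (l_lt w w_s) (s_le v v_s) (s_le w w_s).
  by apply: contraTT; rewrite -!leqNgt => /block_mono.
have f_mono : {in (s : seq nat) &, {mono f : v w / v < w}}.
  move=> v w v_s w_s; case: (ltngtP v w) => [||->]; last by rewrite ltnn.
    by move=> ?; rewrite f_lt.
  by move=> lt_wv; have := f_lt w v w_s v_s lt_wv; lia.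
exists (map f s); last exact: order_isomorphic_map.
apply: (sorted_subset_subseq (@block_le_trans N) (@block_le_anti N)) => //.
- rewrite sorted_map sorted_pairwise; last first.
    by move=> y x z; apply: block_le_trans.
  apply/(pairwiseP 0) => i j lt_i lt_j lt_ij; rewrite !inE in lt_i lt_j.
  have [v_s w_s] := (mem_nth 0 lt_i, mem_nth 0 lt_j).
  (* An ascent of [s] passes to a later layer, hence to a later block; a descent stays in its layer,
     hence in one block, where [f] decreases along with it. *)
  rewrite /block_le /=; case: (ltngtP (nth 0 s i) (nth 0 s j)) => lt_v.
  + by rewrite g_blt ?layer_start_ascent; auto.
  + rewrite (ltnW (f_lt _ _ w_s v_s lt_v)) andbT.
    by rewrite /f (layer_start_descent s_lay lt_ij) // (g_block _ _ (nth 0 s j))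
      ?eqxx ?orbT; auto.
  + by rewrite lt_v eqxx leqnn orbT.
- rewrite map_inj_in_uniq ?permutation_uniq // => v w v_s w_s eq_f.
  case: (ltngtP v w) => // lt_vw.
    by have := f_lt v w v_s w_s lt_vw; rewrite eq_f ltnn.
  by have := f_lt w v w_s v_s lt_vw; rewrite eq_f ltnn.
- by move=> _ /mapP[v v_s ->]; apply: g_in; auto.
Qed.

(** The color is fixed before [s]: which part is at stake, and so which permutation it misses, is
    known only once the color is. *)
Lemma grid_color_class (m n : nat) (c : nat -> 'I_m) :
  exists i : 'I_m, forall s : permutation, layered s -> size s <= n ->
  exists2 t, subseq t [seq x <- grid (m * n) | c x == i] & order_isomorphic t s.
Proof.
set k := m * n; pose N := k.+1.
(* [N] is [m * n + 1], just above the pigeonhole bound, both for the entries of one block and for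
   the number of blocks. *)
have major a : exists i, n < size [seq x <- iota (a * N).+1 N | c x == i].
  by apply: pigeonhole; rewrite size_iota.
pose d a := xchoose (major a).
pose B a := [seq x <- iota (a * N).+1 N | c x == d a].
have B_size a : n < size (B a) := xchooseP (major a).
have [i A_size] : exists i, n < size [seq a <- iota 0 N | d a == i].
  by apply: pigeonhole; rewrite size_iota.
set A := filter _ _ in A_size; exists i => s s_lay le_n.
have A_nth a : a < n -> d (nth 0 A a) = i /\ nth 0 A a < N.
  move=> lt_a; have := mem_nth 0 (ltn_trans lt_a A_size).
  by rewrite mem_filter mem_iota => /andP[/eqP].
have B_nth a v : v <= n ->
    [/\ c (nth 0 (B a) v) = d a, a * N < nth 0 (B a) v
      & nth 0 (B a) v <= a * N + N].
  move=> le_v; have := mem_nth 0 (leq_ltn_trans le_v (B_size a)).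
  by rewrite mem_filter mem_iota addSn ltnS => /andP[/eqP-> /andP[-> ->]].
have B_block a v : v <= n -> block N (nth 0 (B a) v) = a.
  case/(B_nth a) => _; set x := nth _ _ _ => lt_x le_x; rewrite /block.
  have -> : x.-1 = a * N + (x.-1 - a * N) by lia.
  by rewrite divnMDl // divn_small ?addn0 //; lia.
(* [A] and every [B b] are increasing and have more than [n] members, so [nth] never returns its
   default for indices up to [n]. *)
pose g a v := nth 0 (B (nth 0 A a)) v.
apply: (@subseq_of_layered N n _ g) => //.
- exact/filter_uniq/permutation_uniq.
- apply: sorted_filter; [exact: block_le_trans | exact: grid_sorted].
- move=> a v /A_nth[dA lt_A] /(B_nth (nth 0 A a))[cB lt_B le_B].
  rewrite mem_filter mem_grid cB dA eqxx /=; apply/andP; split.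
    by apply: leq_ltn_trans lt_B.
  by apply: leq_trans le_B _; rewrite -mulSnr leq_mul2r lt_A orbT.
- by move=> a v w _ le_v le_w; rewrite /g !B_block.
- move=> a v w _ lt_vw le_w; set b := nth 0 A a.
  have lt_w : w < size (B b) := leq_ltn_trans le_w (B_size b).
  apply: (sorted_ltn_nth ltn_trans) => //; last by rewrite inE (ltn_trans lt_vw).
  by apply: sorted_filter; [exact: ltn_trans | exact: iota_ltn_sorted].
- move=> a b v w lt_ab lt_b le_v le_w; rewrite /g !B_block //.
  have lt_bA : b < size A := ltn_trans lt_b A_size.
  apply: (sorted_ltn_nth ltn_trans) => //; last by rewrite inE (ltn_trans lt_ab).
  by apply: sorted_filter; [exact: ltn_trans | exact: iota_ltn_sorted].
Qed.

(** The mask that cuts [t] out of [q] cuts an isomorphic subsequence out of [p]. *)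
Lemma contains_of_subseq (q t : seq nat) (p s : permutation) :
  order_isomorphic q p -> subseq t q -> order_isomorphic t s -> contains p s.
Proof.
move=> iso_qp /subseqP[b _ ->] [sz_s iso_s].
have [sz_b iso_b] := order_isomorphic_mask b iso_qp.
exists (mask b p); first exact: mask_subseq.
split=> [|i j lt_i lt_j]; first by rewrite -sz_b.
by rewrite -iso_b ?sz_b // iso_s // sz_b.
Qed.

Theorem mainTheorem4 : unsplittable layered.
Proof.
move=> [m [P [split_P nontriv_P]]].
(* Each part misses some layered permutation; one is chosen for every index at once. *)
have /fin_all_exists[f f_bad] i : exists s, layered s /\ ~ P i s.
  have [s s_bad] := not_all_ex_not _ _ (nontriv_P i).
  by exists s; apply: imply_to_and s_bad.
pose n := \max_i size (f i).
have [c c_class] := split_P _ (@grid_layered (m * n)).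
have [i] := grid_color_class n c.
have [f_lay f_notP] := f_bad i.
move=> /(_ _ f_lay (leq_bigmax i))[t sub_t iso_t].
case: (c_class i) => [q0 | [p Pp iso_p]].
  (* An empty color class would make [f i] empty, but permutations are nonempty. *)
  move: sub_t iso_t; rewrite q0 subseq0 => /eqP -> [/esym /eqP].
  by case/andP: (perm_seqP (f i)) => /lt0n_neq0/negPf->.
apply: f_notP; exact: in_classP Pp (contains_of_subseq iso_p sub_t iso_t).
Qed.
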